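(* If $f,g\in F_{\mathcal{OP}^2}$ are multiplicative, then so is their convolution $f*g$, and $$Z_{f*g}(z)=Z_g(Z_f(z)).$$
   Context: $\mathbb N=\{1,2,\dots\}$, $[n]=\{1,\dots,n\}$. An ordered set partition of $[n]$ is a sequence $\pi=(P_1,\dots,P_p)$ of pairwise disjoint nonempty blocks with union $[n]$; $\mathcal{OP}_n$ is the set of them; $\bar\pi$ is the underlying set partition; set partitions are ordered by refinement. For $\pi=(P_1,\dots,P_p)$, $\sigma=(S_1,\dots,S_s)$ we write $\pi\le\sigma$ iff $\bar\pi\le\bar\sigma$ and, whenever $i<j$, $P_i\subseteq S_k$, $P_j\subseteq S_l$, one has $k\le l$. For $\sigma\le\pi=(P_1,\dots,P_p)$ the type of $[\sigma,\pi]$ is $(k_1,\dots,k_p)$, $k_i$ the number of blocks of $\sigma$ contained in $P_i$. $F_{\mathcal{OP}^2}$ is the set of $\mathbb C$-valued functions $f(\sigma,\pi)$ on pairs $\sigma\le\pi$ in $\mathcal{OP}_n$, $n$ ranging over $\mathbb N$; convolution is $(f*g)(\sigma,\pi)=\sum_{\sigma\le\rho\le\pi}f(\sigma,\rho)g(\rho,\pi)$. $f\in F_{\mathcal{OP}^2}$ is multiplicative if there is a (defining) sequence $(f_n)_{n\ge1}\subseteq\mathbb C$ such that $f(\sigma,\pi)=\prod_{i=1}^pf_{k_i}$ whenever $[\sigma,\pi]$ has type $(k_1,\dots,k_p)$; then $f_n=f(\hat0_n,\hat1_n)$ with $\hat0_n=(\{1\},\dots,\{n\})$, $\hat1_n=([n])$.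 Its generating function is the formal power series $Z_f(z)=\sum_{n=1}^\infty f_nz^n$. *)

(* Defs.v *)
From HB Require Import structures.
From mathcomp Require Import all_boot all_order all_algebra.
From mathcomp Require Import complex.
From mathcomp Require Import reals.

Set Implicit Arguments.
Unset Strict Implicit.
Unset Printing Implicit Defensive.

Import GRing.Theory.

Local Open Scope ring_scope.

(* The block {1, .., n} is represented by 'I_n = {0, .., n - 1}. *)
Definition is_ordered_partition (n : nat) (s : seq {set 'I_n}) : bool :=
  [&& set0 \notin s, pairwise (fun A B : {set 'I_n} => [disjoint A & B]) s
    & \bigcup_(B <- s) B == setT].

Record ordered_partition (n : nat) := OrderedPartition {
  blocks :> seq {set 'I_n};
  _ : is_ordered_partition blocks
}.

HB.instance Definition _ n := [isSub for @blocks n].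
HB.instance Definition _ n := [Choice of ordered_partition n by <:].

Lemma size_blocks n (s : ordered_partition n) : (size s <= n)%N.
Proof.
case: s => s /= /and3P[s0 ds _].
suff H : (size s <= #|\bigcup_(B <- s) B|)%N.
  by apply: leq_trans H _; rewrite -[leqRHS]card_ord max_card.
elim: s s0 ds => [//|A s IHs] /=.
rewrite inE negb_or eq_sym => /andP[A0 s0] /andP[dA ds].
rewrite big_cons cardsU disjoint_setI0 ?cards0 ?subn0.
  by rewrite -add1n leq_add ?IHs // card_gt0.
rewrite bigcup_seq; apply: bigcup_disjoint => B Bs.
exact: (allP dA).
Qed.

Definition bseq_of_blocks n (s : ordered_partition n) : {bseq n of {set 'I_n}} :=
  Bseq (size_blocks s).

Lemma bseq_of_blocksK n :
  pcancel (@bseq_of_blocks n) (fun b => insub (bseqval b)).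
Proof. by move=> s; exact: valK. Qed.

HB.instance Definition _ n := [Countable of ordered_partition n by <:].
HB.instance Definition _ n : isFinite (ordered_partition n) :=
  PCanIsFinite (@bseq_of_blocksK n).

Definition underlying n (p : ordered_partition n) : {set {set 'I_n}} :=
  [set B in blocks p].

Definition refines n (P Q : {set {set 'I_n}}) : bool :=
  [forall B in P, [exists C in Q, B \subset C]].

Definition op_le n (p s : ordered_partition n) : bool :=
  refines (underlying p) (underlying s) &&
  [forall i : 'I_(size p), forall j : 'I_(size p),
   forall k : 'I_(size s), forall l : 'I_(size s),
     [&& (i < j)%N, nth set0 p i \subset nth set0 s k
       & nth set0 p j \subset nth set0 s l] ==> (k <= l)%N].

Notation "s <=o p" := (op_le s p) (at level 70, no associativity).

Definition interval_type n (s p : ordered_partition n) : seq nat :=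
  [seq count (fun B : {set 'I_n} => B \subset P) s | P : {set 'I_n} <- blocks p].

Lemma op0_subproof n : is_ordered_partition [seq [set i] | i <- enum 'I_n].
Proof.
apply/and3P; split.
- apply/mapP => -[i _ /setP/(_ i)]; by rewrite !inE eqxx.
- rewrite pairwise_map.
  have := enum_uniq 'I_n; rewrite uniq_pairwise.
  by apply: sub_pairwise => i j /= ij; rewrite disjoints1 inE.
- apply/eqP/setP => i; rewrite bigcup_seq !inE; apply/bigcupP.
  by exists [set i]; rewrite ?set11 // map_f // mem_enum.
Qed.

Definition op0 n : ordered_partition n := OrderedPartition (op0_subproof n).

Lemma op1_subproof n : is_ordered_partition [:: [set: 'I_n.+1]].
Proof.
rewrite /is_ordered_partition /= inE big_seq1 eqxx !andbT.
by apply/eqP => /setP/(_ ord0); rewrite !inE.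
Qed.

Definition op1 n : ordered_partition n.+1 := OrderedPartition (op1_subproof n).

Lemma op0_le_op1 n : op0 n.+1 <=o op1 n.
Proof.
apply/andP; split.
  apply/forall_inP => B _; apply/exists_inP.
  by exists setT; rewrite ?subsetT // !inE.
apply/forallP => i; apply/forallP => j; apply/forallP => k; apply/forallP => l.
by rewrite (ord1 k) (ord1 l) leqnn implybT.
Qed.

Section Incidence.
Variable R : realType.

(* As n ranges over the positive integers, the index n stands for the
   partitions of the (n + 1)-element set. *)
Definition op_fun :=
  forall (n : nat) (s p : ordered_partition n.+1), s <=o p -> R[i].

Definition op_conv (f g : op_fun) : op_fun := fun n s p _ =>
  \sum_(r : {r : ordered_partition n.+1 | (s <=o r) && (r <=o p)})
     f n s (val r) (proj1 (andP (valP r))) *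
     g n (val r) p (proj2 (andP (valP r))).

(* All entries of interval_type s p are positive when s <=o p, so a 0 plays
   no role. *)
Definition defining_seq (f : op_fun) (a : nat -> R[i]) : Prop :=
  forall (n : nat) (s p : ordered_partition n.+1) (sp : s <=o p),
    f n s p sp = \prod_(k <- interval_type s p) a k.

Definition multiplicative (f : op_fun) : Prop :=
  exists a : nat -> R[i], defining_seq f a.

(* Formal power series are given by their coefficient sequences. *)
Definition fps := nat -> R[i].

Definition fps_one : fps := fun n => (n == 0%N)%:R.

Definition fps_mul (A B : fps) : fps :=
  fun n => \sum_(i < n.+1) A i * B (n - i)%N.

Definition fps_exp (A : fps) (k : nat) : fps := iter k (fps_mul A) fps_one.

(* A(B(z)) = \sum_k A_k B(z)^k, for B without constant term: the coefficient
   of z^n in B(z)^k is then zero for k > n. *)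
Definition fps_comp (A B : fps) : fps :=
  fun n => \sum_(k < n.+1) A k * fps_exp B k n.

Definition gen_fun (f : op_fun) : fps :=
  fun n => if n is m.+1 then f m (op0 m.+1) (op1 m) (op0_le_op1 m) else 0.

Lemma gen_fun_defining_seq (f : op_fun) (a : nat -> R[i]) n :
  defining_seq f a -> (0 < n)%N -> gen_fun f n = a n.
Proof.
case: n => // n fa _; rewrite /= fa /interval_type /= big_seq1.
congr a; rewrite (eq_count (a2 := predT)) => [|B]; last by rewrite subsetT.
by rewrite count_predT size_map size_enum_ord.
Qed.

End Incidence.

(* Main.v *)
Require Import Defs.
From mathcomp Require Import all_boot all_order all_algebra.
From mathcomp Require Import complex.
From mathcomp Require Import reals.

(** Going up in the order on ordered partitions means merging consecutive
    blocks.  Hence the ordered partitions [r] above a fixed [s] with [m] blocks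
    correspond to the compositions of [m], [r] being sent to the type of [s, r];
    this is [op_leP] together with its converse [merge_op].

    Merging twice is merging once, by the block sums ([merge_merge]).  So if
    [s, p] has type (d_1, .., d_k), then a partition [r] between [s] and [p] is
    the same thing as a list (c_1, .., c_k) where c_i is a composition of d_i:
    the concatenation of the c_i is the type of [s, r], and the list of their
    lengths is the type of [r, p] ([chain_typeK], [chain_type_ex]).  Summing
    over such lists factorizes, so if f and g have the defining sequences a
    and b, then f * g has the defining sequence

      h_d = \sum_(c composition of d) b_(length of c) \prod_(i in c) a_i,

    and grouping the compositions by their length k turns this sum into the
    coefficient of z^d in \sum_k b_k Z_f(z)^k = Z_g(Z_f(z)) ([fps_compE]).

    The order is first studied on lists of disjoint nonempty sets without the
    condition that they cover a given set, since this is what makes induction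
    on the list possible: removing the first block of [p] removes the prefix of
    [s] that it covers. *)

Set Implicit Arguments.
Unset Strict Implicit.
Unset Printing Implicit Defensive.

(** * Merging consecutive blocks of a list of disjoint sets *)

Lemma size_le_sumn c : 0 \notin c -> size c <= sumn c.
Proof.
elim: c => [//|k c IHc]; rewrite inE negb_or eq_sym -lt0n /= => /andP[k0 /IHc].
by rewrite -add1n; apply: leq_add.
Qed.

Section Merging.
Variable T : finType.
Implicit Types (s p : seq {set T}) (c e : seq nat) (A B C P : {set T}).

Definition cup s : {set T} := \bigcup_(B <- s) B.

Definition block_list s :=
  (set0 \notin s) && pairwise (fun A B => [disjoint A & B]) s.

(** By disjointness at most one block of [p] contains a nonempty [B], so taking
    the first one is no choice; the value is [size p] when there is none. *)
Definition block_index p B := find (fun C => B \subset C) p.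

(** The order on ordered partitions, stated so that induction on [p] applies:
    the last clause stands for the condition that both lists cover the whole
    ground set, which is lost when their first blocks are removed. *)
Definition finer s p :=
  [&& all (fun B => has (fun C => B \subset C) p) s,
      pairwise (fun A B => block_index p A <= block_index p B) s
    & cup s == cup p].

Definition merge c s := [seq cup bs | bs <- reshape c s].

Lemma cup_cons B s : cup (B :: s) = B :|: cup s.
Proof. by rewrite /cup big_cons. Qed.

Lemma cup_cat s1 s2 : cup (s1 ++ s2) = cup s1 :|: cup s2.
Proof. by rewrite /cup big_cat. Qed.

Lemma cup_subP s A :
  reflect (forall B, B \in s -> B \subset A) (cup s \subset A).
Proof. by rewrite /cup bigcup_seq; exact: bigcupsP. Qed.

Lemma sub_cup s B : B \in s -> B \subset cup s.
Proof. exact: (cup_subP s _ (subxx _)). Qed.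

Lemma disjoint_cup s A :
  (forall B, B \in s -> [disjoint A & B]) -> [disjoint A & cup s].
Proof.
by move=> AB; rewrite /cup bigcup_seq; apply: bigcup_disjoint => B /AB.
Qed.

Lemma block_list_cons B s : block_list (B :: s) =
  [&& B != set0, all (fun C => [disjoint B & C]) s & block_list s].
Proof.
rewrite /block_list /= inE negb_or eq_sym.
by case: (_ == _); case: (all _ _); case: (_ \notin _).
Qed.

Lemma block_list_cat s1 s2 : block_list (s1 ++ s2) =
  [&& block_list s1, block_list s2 & [disjoint cup s1 & cup s2]].
Proof.
rewrite /block_list mem_cat negb_or pairwise_cat.
suff -> : allrel (fun A B : {set T} => [disjoint A & B]) s1 s2
          = [disjoint cup s1 & cup s2].
  by case: (_ \notin s1); case: (_ \notin s2); case: (pairwise _ s1);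
     case: (pairwise _ s2); case: [disjoint _ & _].
apply/allrelP/idP => [dis|dis A B s1A s2B].
  apply: disjoint_cup => B s2B; rewrite disjoint_sym.
  by apply: disjoint_cup => A s1A; rewrite disjoint_sym dis.
exact: disjointW (sub_cup s1A) (sub_cup s2B) dis.
Qed.

Lemma disjoint_nsub A B C :
  B != set0 -> B \subset A -> [disjoint A & C] -> ~~ (B \subset C).
Proof.
case/set0Pn=> x Bx BA AC; apply/negP => BC.
by have := disjointFr AC (subsetP BA _ Bx); rewrite (subsetP BC _ Bx).
Qed.

Lemma block_neq0 s B : block_list s -> B \in s -> B != set0.
Proof. by case/andP=> s0 _ sB; apply: contraNneq s0 => <-. Qed.

Lemma block_index_nth p B k : block_list p -> B != set0 -> k < size p ->
  B \subset nth set0 p k -> block_index p B = k.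
Proof.
move=> + B0; elim: p k => [//|P p IHp] [|k] /=.
  by move=> _ _; rewrite /block_index /= => ->.
rewrite block_list_cons => /and3P[_ /allP Pp pp] lt_k Bk.
have dis := Pp _ (mem_nth set0 lt_k); rewrite disjoint_sym in dis.
by rewrite /block_index /= (negPf (disjoint_nsub B0 Bk dis)) -/(block_index p B) (IHp k).
Qed.

Lemma mergeS k c s : merge (k :: c) s = cup (take k s) :: merge c (drop k s).
Proof. by []. Qed.

Lemma cup_merge c s : sumn c = size s -> cup (merge c s) = cup s.
Proof.
elim: c s => [|k c IHc] s /= => [/esym/size0nil -> //|c_s].
by rewrite mergeS cup_cons IHc ?size_drop -?c_s ?addKn // -cup_cat cat_take_drop.
Qed.

Lemma size_merge c s : size (merge c s) = size c.
Proof. by rewrite size_map size_reshape. Qed.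

Lemma cup_eq0 s : block_list s -> (cup s == set0) = (s == [::]).
Proof.
case: s => [|B s]; first by rewrite /cup big_nil !eqxx.
by rewrite block_list_cons cup_cons setU_eq0 => /and3P[/negPf->].
Qed.

(** A composition [k :: c] of the length of [s] cuts off a nonempty prefix
    [s1] of length [k], which is merged into a single block, and leaves a
    list [s2] to which [c] applies: the induction step for [merge]. *)
Variant head_spec k c s : Prop :=
  HeadSpec s1 s2 of s = s1 ++ s2 & size s1 = k & s1 != [::] & 0 \notin c
  & sumn c = size s2 & block_list s1 & block_list s2 & [disjoint cup s1 & cup s2].

Lemma headP k c s : block_list s -> 0 \notin k :: c -> sumn (k :: c) = size s ->
  head_spec k c s.
Proof.
move=> + + /= c_s; rewrite inE negb_or -{1}[s](cat_take_drop k) block_list_cat.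
case/and3P=> bl1 bl2 dis /andP[k0 c0].
have le_ks : k <= size s by rewrite -c_s leq_addr.
apply: (HeadSpec (s1 := take k s) (s2 := drop k s)) => //.
- by rewrite cat_take_drop.
- by rewrite size_takel.
- by rewrite -size_eq0 size_takel // eq_sym.
- by rewrite size_drop -c_s addKn.
Qed.

Lemma merge_block_list c s : block_list s -> 0 \notin c -> sumn c = size s ->
  block_list (merge c s).
Proof.
elim: c s => [//|k c IHc] s bls c0 c_s.
have [s1 s2 -> <- s1N0 {}c0 {}c_s bl1 bl2 dis] := headP bls c0 c_s.
rewrite mergeS take_size_cat // drop_size_cat // block_list_cons IHc //.
rewrite cup_eq0 // s1N0 andbT; apply/allP => C C_in.
by apply: disjointWr dis; rewrite -(cup_merge c_s) sub_cup.
Qed.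

Lemma merge_finer c s : block_list s -> 0 \notin c -> sumn c = size s ->
  finer s (merge c s).
Proof.
move=> bls c0 c_s; rewrite /finer cup_merge // eqxx andbT.
elim: c s bls c0 c_s => [|k c IHc] s bls c0 c_s.
  by have/esym/size0nil-> := c_s.
have [s1 s2 -> <- s1N0 {}c0 {}c_s bl1 bl2 dis] := headP bls c0 c_s.
rewrite mergeS take_size_cat // drop_size_cat //.
have in1 B : B \in s1 -> B \subset cup s1 by exact: sub_cup.
have in2 B : B \in s2 -> B \subset cup s1 = false.
  move=> s2B; apply/negbTE; move: dis; rewrite disjoint_sym.
  exact: disjoint_nsub (block_neq0 bl2 s2B) (sub_cup s2B).
have /andP[all2 pw2] := IHc s2 bl2 c0 c_s.
rewrite all_cat pairwise_cat; apply/and3P; split.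
- apply/andP; split; apply/allP => B sB /=; first by rewrite in1.
  by rewrite (allP all2) ?orbT.
- by apply/allrelP => A B s1A _; rewrite /block_index /= in1.
apply/andP; split.
  (* On [s1] all positions are 0. *)
  have : pairwise (fun _ _ => true) s1 by elim: (s1) => //= A s' ->; rewrite all_predT.
  by apply: (@sub_in_pairwise _ (mem s1)) (allss _) => A B s1A _ _; rewrite /block_index /= in1.
(* On [s2] the new first block shifts all positions by one. *)
apply: (@sub_in_pairwise _ (mem s2)) (allss _) pw2 => A B s2A s2B.
by rewrite /block_index /= !in2.
Qed.

(** The composition can be read off the merged list: a nonempty block of [s]
    lies in the union that it was merged into and in no other one, these being
    disjoint.  So merging is injective in the composition. *)
Lemma count_merge c s : block_list s -> 0 \notin c -> sumn c = size s ->
  [seq count (fun B : {set T} => B \subset P) s | P : {set T} <- merge c s] = c.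
Proof.
elim: c s => [//|k c IHc] s bls c0 c_s.
have [s1 s2 -> <- s1N0 {}c0 {}c_s bl1 bl2 dis] := headP bls c0 c_s.
rewrite mergeS take_size_cat // drop_size_cat //= -[in RHS](IHc _ bl2 c0 c_s).
congr (_ :: _).
  rewrite count_cat [X in X + _](_ : _ = size s1); last first.
    by apply/eqP; rewrite -all_count; apply/allP => B /sub_cup.
  rewrite [X in _ + X](_ : _ = 0) ?addn0 //; apply/eqP.
  rewrite -leqn0 leqNgt -has_count; apply/hasPn => B s2B.
  rewrite disjoint_sym in dis.
  exact: disjoint_nsub (block_neq0 bl2 s2B) (sub_cup s2B) dis.
apply/eq_in_map => C C_in /=; rewrite count_cat [X in X + _](_ : _ = 0) //.
apply/eqP; rewrite -leqn0 leqNgt -has_count; apply/hasPn => B s1B.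
apply: disjoint_nsub (block_neq0 bl1 s1B) (sub_cup s1B) _.
by apply: disjointWr dis; rewrite -(cup_merge c_s) sub_cup.
Qed.

Lemma filter_prefix (X : Type) (a : pred X) (s : seq X) :
  pairwise (fun x y => a y ==> a x) s ->
  s = filter a s ++ filter (predC a) s.
Proof.
elim: s => [//|x s IHs] /= /andP[xs /IHs def_s].
case: ifP => ax /=; first by rewrite -def_s.
suff s0 : filter a s = [::] by rewrite {1}def_s s0.
apply/size0nil/eqP; rewrite size_filter -leqn0 leqNgt -has_count -all_predC.
by apply: sub_all xs => y /=; rewrite ax implybF.
Qed.

(** By monotonicity of the positions, the blocks of [s] contained in the first
    block [P] of [p] form a prefix [s1] of [s].  The remaining ones lie in later
    blocks of [p], which are disjoint from [P]; since both lists cover the same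
    set, [s1] covers exactly [P] and the rest of [s] is again below the rest of
    [p]. *)
Lemma finer_merge s p : block_list s -> block_list p -> finer s p ->
  exists c, [/\ 0 \notin c, sumn c = size s & p = merge c s].
Proof.
elim: p s => [|P p IHp] s bls.
  by case: s bls => [|B s] // _ _ _; exists [::].
rewrite block_list_cons => /and3P[P0 /allP Pp blp] /and3P[/allP s_p pws /eqP s_eq].
have def_s : s = filter (fun B => B \subset P) s ++
                 filter (predC (fun B => B \subset P)) s.
  apply: filter_prefix; apply: sub_pairwise pws => A B.
  by rewrite /block_index /=; case: (B \subset P) => //; case: (A \subset P).
set s1 := filter _ s in def_s; set s2 := filter _ s in def_s.
have in2 B : B \in s2 -> B \subset P = false.
  by rewrite mem_filter => /andP[/negPf].
have has2 B : B \in s2 -> has (fun C => B \subset C) p.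
  move=> s2B; have: B \in s by rewrite def_s mem_cat s2B orbT.
  by move/s_p => /=; rewrite in2.
have s1P : cup s1 \subset P by apply/cup_subP => B; rewrite mem_filter => /andP[].
have s2p : cup s2 \subset cup p.
  by apply/cup_subP => B /has2/hasP[C pC BC]; apply: subset_trans BC (sub_cup pC).
have dPp : [disjoint P & cup p] by apply: disjoint_cup.
have s12 : cup s1 :|: cup s2 = P :|: cup p by rewrite -cup_cat -def_s s_eq cup_cons.
(* Two inclusions into disjoint sets with the same total union are
   equalities. *)
have eq1 : cup s1 = P.
  apply/eqP; rewrite eqEsubset s1P; apply/subsetP => x Px.
  have: x \in cup s1 :|: cup s2 by rewrite s12 inE Px.
  by case/setUP=> // /(subsetP s2p); rewrite (disjointFr dPp Px).
have eq2 : cup s2 = cup p.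
  apply/eqP; rewrite eqEsubset s2p; apply/subsetP => x px.
  have: x \in cup s1 :|: cup s2 by rewrite s12 inE px orbT.
  by case/setUP=> // /(subsetP s1P); rewrite (disjointFl dPp px).
move: bls; rewrite {1}def_s block_list_cat => /and3P[bl1 bl2 _].
have [|c [c0 c_s2 ->]] := IHp s2 bl2 blp.
  rewrite /finer eq2 eqxx andbT; apply/andP; split; first exact/allP.
  have: pairwise (fun A B => block_index (P :: p) A <= block_index (P :: p) B) s2.
    by move: pws; rewrite def_s pairwise_cat => /and3P[].
  apply: (@sub_in_pairwise _ (mem s2)) (allss _) => A B s2A s2B.
  by rewrite /block_index /= !in2.
exists (size s1 :: c); split.
- rewrite inE negb_or c0 andbT eq_sym size_eq0 -cup_eq0 // eq1 //.
- by rewrite /= c_s2 -size_cat -def_s.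
- by rewrite mergeS {1 2}def_s take_size_cat // drop_size_cat // eq1.
Qed.

Lemma take_merge k c s : take k (merge c s) = merge (take k c) s.
Proof. by elim: k c s => [|k IHk] [|n c] s //=; rewrite !mergeS /= IHk. Qed.

Lemma drop_merge k c s :
  drop k (merge c s) = merge (drop k c) (drop (sumn (take k c)) s).
Proof.
elim: k c s => [|k IHk] [|n c] s //=; rewrite ?drop0 //.
by rewrite IHk drop_drop addnC.
Qed.

Lemma cup_merge_take c s : cup (merge c s) = cup (take (sumn c) s).
Proof.
elim: c s => [|k c IHc] s; first by rewrite take0.
by rewrite mergeS cup_cons IHc -cup_cat -takeD.
Qed.

(** The second merging groups the entries of [c] along [e], and each group
    merges as many blocks of [s] as its sum says. *)
Lemma merge_merge e c s :
  merge e (merge c s) = merge [seq sumn k | k <- reshape e c] s.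
Proof.
elim: e c s => [//|k e IHe] c s.
by rewrite mergeS take_merge drop_merge IHe cup_merge_take.
Qed.

End Merging.

(** * Intervals of ordered partitions and compositions *)

Section OrderedPartitions.
Variable n : nat.
Implicit Types s r p : ordered_partition n.

Lemma block_list_op p : block_list p.
Proof. by case: p => p /= /and3P[p0 pp _]; rewrite /block_list p0. Qed.

Lemma cup_op p : cup p = setT.
Proof. by case: p => p /= /and3P[_ _ /eqP]. Qed.

Lemma op_leE s p : s <=o p = finer s p.
Proof.
rewrite /finer !cup_op eqxx andbT; apply/idP/idP.
  case/andP=> /forall_inP ref /forallP ord.
  have {ref} all_s : all (fun B : {set 'I_n} => has (fun C : {set 'I_n} => B \subset C) p) s.
    apply/allP => B sB; have := ref B; rewrite inE => /(_ sB)/exists_inP[C].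
    by rewrite inE => pC BC; apply/hasP; exists C.
  rewrite all_s; apply/(pairwiseP set0) => i j /= lt_i lt_j lt_ij.
  have lt_b k : k < size s -> block_index p (nth set0 s k) < size p.
    by move=> lt_k; rewrite -has_find (allP all_s) // mem_nth.
  have sub_b k : k < size s ->
      nth set0 s k \subset nth set0 p (block_index p (nth set0 s k)).
    by move/lt_b => lt_k; apply: (nth_find set0 (a := fun C => _ \subset C));
       rewrite has_find.
  have /forallP/(_ (Ordinal lt_j))/forallP/(_ (Ordinal (lt_b _ lt_i))) :=
    ord (Ordinal lt_i).
  move/forallP/(_ (Ordinal (lt_b _ lt_j)))/implyP; apply.
  by rewrite /= lt_ij !sub_b.
case/andP=> /allP all_s pw; apply/andP; split.
  apply/forall_inP => B; rewrite inE => /all_s/hasP[C pC BC].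
  by apply/exists_inP; exists C; rewrite ?inE.
apply/forallP=> i; apply/forallP=> j; apply/forallP=> k; apply/forallP=> l.
apply/implyP => /and3P[lt_ij ik jl].
have s0 (m : 'I_(size s)) : nth set0 s m != set0.
  by apply: block_neq0 (block_list_op s) _; rewrite mem_nth.
have blp := block_list_op p.
rewrite -(block_index_nth blp (s0 i) _ ik) // -(block_index_nth blp (s0 j) _ jl) //.
have /(pairwiseP set0) le_idx := pw.
by apply: le_idx lt_ij; rewrite inE.
Qed.

Lemma op_leP s p : s <=o p ->
  [/\ 0 \notin interval_type s p, sumn (interval_type s p) = size s
    & blocks p = merge (interval_type s p) s].
Proof.
rewrite op_leE => /(finer_merge (block_list_op s) (block_list_op p)).
case=> c [c0 c_s def_p].
have c_eq : interval_type s p = c.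
  by rewrite /interval_type def_p count_merge ?block_list_op.
by rewrite c_eq.
Qed.

Lemma merge_op s c : 0 \notin c -> sumn c = size s ->
  exists2 r, s <=o r & interval_type s r = c /\ blocks r = merge c s.
Proof.
move=> c0 c_s; have bls := block_list_op s.
have := merge_block_list bls c0 c_s; have := cup_merge c_s.
rewrite cup_op => cupT /andP[r0 rr].
have r_op : is_ordered_partition (merge c s).
  by apply/and3P; split=> //; apply/eqP.
exists (OrderedPartition r_op); first by rewrite op_leE merge_finer.
by rewrite /interval_type count_merge.
Qed.

Lemma interval_type_inj s r r' : s <=o r -> s <=o r' ->
  interval_type s r = interval_type s r' -> r = r'.
Proof.
move=> /op_leP[_ _ def_r] /op_leP[_ _ def_r'] eq_c.
by apply: val_inj; rewrite /= def_r def_r' eq_c.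
Qed.

Lemma interval_type_merge s p c : 0 \notin c -> sumn c = size s ->
  blocks p = merge c s -> interval_type s p = c.
Proof.
by move=> c0 c_s def_p; rewrite /interval_type def_p count_merge ?block_list_op.
Qed.

(** The type of [s, r] cut into one composition for each block of [p]. *)
Definition chain_type s p r := reshape (interval_type r p) (interval_type s r).

(** The list [chain_type s p r] encodes the types of all three intervals: as
    [p] is obtained from [r], and [r] from [s], by merging, [merge_merge] yields
    the type of [s, p], and the other two equations undo [reshape]. *)
Lemma chain_typeK s r p : s <=o r -> r <=o p ->
  [/\ flatten (chain_type s p r) = interval_type s r,
      shape (chain_type s p r) = interval_type r p
    & [seq sumn c | c <- chain_type s p r] = interval_type s p].
Proof.
move=> /op_leP[c0 c_s def_r] /op_leP[e0 e_r def_p].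
have e_c : sumn (interval_type r p) = size (interval_type s r).
  by rewrite e_r def_r size_merge.
have fl : flatten (chain_type s p r) = interval_type s r.
  by rewrite reshapeKr ?e_c.
have sh : shape (chain_type s p r) = interval_type r p.
  by rewrite reshapeKl ?e_c.
split=> //; apply/esym/interval_type_merge.
- apply/mapP => -[c c_in c_sum]; case/negP: e0; rewrite -sh.
  suff <- : size c = 0 by exact: map_f.
  apply/eqP; rewrite -leqn0 c_sum size_le_sumn //; apply: contra c0 => c0.
  by rewrite -fl; apply/flattenP; exists c.
- by rewrite -sumn_flatten fl.
- by rewrite def_p def_r merge_merge.
Qed.

(** Merging [s] along the concatenation of [cs] gives [r]; merging [r] further
    along the lengths of the members of [cs] merges [s] along their sums, so it
    gives back [p]. *)
Lemma chain_type_ex s p cs : s <=o p ->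
  [seq sumn c | c <- cs] = interval_type s p ->
  0 \notin flatten cs ->
  exists2 r, (s <=o r) && (r <=o p) & chain_type s p r = cs.
Proof.
move=> /op_leP[d0 d_s def_p] cs_d c0.
have c_s : sumn (flatten cs) = size s by rewrite sumn_flatten cs_d.
have [r sr [c_eq def_r]] := merge_op c0 c_s.
have e0 : 0 \notin shape cs.
  apply: contra d0 => /mapP[[|//] c_in _].
  by rewrite -cs_d; apply/mapP; exists [::].
have e_r : sumn (shape cs) = size r.
  by rewrite def_r size_merge size_flatten.
have def_p' : blocks p = merge (shape cs) r.
  by rewrite def_r merge_merge flattenK cs_d.
exists r; first by rewrite sr op_leE def_p' merge_finer ?block_list_op.
by rewrite /chain_type c_eq (interval_type_merge e0 e_r def_p') flattenK.
Qed.

End OrderedPartitions.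

(** * Enumeration of compositions *)

Fixpoint compositions_in k n : seq (seq nat) :=
  if k is k'.+1 then [seq i :: c | i <- iota 1 n, c <- compositions_in k' (n - i)]
  else if n is 0 then [:: [::]] else [::].

Lemma mem_compositions_in k n c :
  (c \in compositions_in k n) = [&& size c == k, sumn c == n & 0 \notin c].
Proof.
elim: k n c => [|k IHk] n c /=.
  by case: n => [|n]; case: c.
apply/allpairsPdep/and3P => [[i [c' []]]|].
  rewrite mem_iota IHk add1n ltnS => /andP[i0 le_in] /and3P[/eqP<- /eqP c_n c0] ->.
  by rewrite /= c_n subnKC // !eqxx inE negb_or (eq_sym 0) -lt0n i0.
case: c => [[]//|i c] /= []; rewrite eqSS inE negb_or (eq_sym 0) -lt0n.
move=> c_k /eqP<- /andP[i0 c0]; exists i, c; split=> //.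
  by rewrite mem_iota i0 add1n ltnS leq_addr.
by rewrite IHk c_k addKn eqxx.
Qed.

Lemma compositions_in_uniq k n : uniq (compositions_in k n).
Proof.
elim: k n => [|k IHk] n /=; first by case: n.
apply: allpairs_uniq_dep => [|i _|]; [exact: iota_uniq | exact: IHk |].
by move=> [i c] [j d] _ _ /= [-> ->].
Qed.

Definition compositions n := flatten [seq compositions_in k n | k <- iota 0 n.+1].

Lemma mem_compositions n c : (c \in compositions n) = (sumn c == n) && (0 \notin c).
Proof.
apply/flatten_mapP/andP => [[k _]|[/eqP c_n c0]].
  by rewrite mem_compositions_in => /and3P[].
exists (size c); last by rewrite mem_compositions_in c_n c0 !eqxx.
by rewrite mem_iota add0n ltnS -c_n size_le_sumn.
Qed.

Lemma compositions_uniq n : uniq (compositions n).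
Proof.
have -> : compositions n =
    [seq c | k <- iota 0 n.+1, c <- compositions_in k n].
  by congr flatten; apply: eq_map => k; rewrite map_id.
apply: allpairs_uniq_dep => [|k _|]; [exact: iota_uniq | exact: compositions_in_uniq |].
move=> [k c] [l d] /allpairsPdep[k' [c' [_ + [-> ->]]]].
rewrite mem_compositions_in => /and3P[/eqP<- _ _].
move=> /allpairsPdep[l' [d' [_ + [-> ->]]]].
by rewrite mem_compositions_in => /and3P[/eqP<- _ _] /= ->.
Qed.

(** The possible values of [chain_type s p] when [s, p] has type [ds]. *)
Fixpoint composition_lists (ds : seq nat) : seq (seq (seq nat)) :=
  if ds is d :: ds' then
    [seq c :: cs | c <- compositions d, cs <- composition_lists ds']
  else [:: [::]].

Lemma mem_composition_lists ds cs : (cs \in composition_lists ds) =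
  ([seq sumn c | c <- cs] == ds) && (0 \notin flatten cs).
Proof.
elim: ds cs => [|d ds IHds] cs /=; first by case: cs.
apply/allpairsP/andP => [[[c cs'] /= []]|].
  rewrite mem_compositions IHds => /andP[/eqP<- c0] /andP[/eqP<- cs0] ->.
  by rewrite /= eqxx mem_cat negb_or c0.
case: cs => [[]//|c cs] /= [/eqP[c_d cs_ds]]; rewrite mem_cat negb_or => /andP[c0 cs0].
by exists (c, cs); rewrite /= mem_compositions IHds c_d cs_ds !eqxx.
Qed.

Lemma composition_lists_uniq ds : uniq (composition_lists ds).
Proof.
elim: ds => [//|d ds IHds] /=.
apply: allpairs_uniq => //; first exact: compositions_uniq.
by move=> [c cs] [c' cs'] _ _ /= [-> ->].
Qed.

(** * Composition of power series as a sum over compositions *)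

Section Series.
Import GRing.Theory.
Local Open Scope ring_scope.
Variable R : realType.
Implicit Types (A B a b : fps R).

(** Expanding the power gives one term for each list of [k] exponents with sum
    [n]; as the constant term vanishes, only the lists of positive exponents
    contribute. *)
Lemma fps_expE A k n : A 0%N = 0 ->
  fps_exp A k n = \sum_(c <- compositions_in k n) \prod_(i <- c) A i.
Proof.
move=> A0; elim: k n => [|k IHk] n.
  rewrite /fps_exp /= /fps_one.
  by case: n => [|n] /=; rewrite ?big_nil // big_seq1 big_nil.
rewrite /fps_exp iterS -/(fps_exp A k) /fps_mul big_ord_recl A0 mul0r add0r.
rewrite big_allpairs_dep /= (iotaDl 1 0) big_map /=.
rewrite -[in RHS](subn0 n) -/(index_iota 0 n) big_mkord.
apply: eq_bigr => i _; rewrite subn0 IHk big_distrr /=.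
by apply: eq_bigr => c _; rewrite big_cons.
Qed.

Lemma fps_compE b a n : a 0%N = 0 ->
  fps_comp b a n =
    \sum_(c <- compositions n) b (size c) * \prod_(i <- c) a i.
Proof.
move=> a0; rewrite big_flatten big_map -[n.+1]subn0 -/(index_iota 0 n.+1) big_mkord.
apply: eq_bigr => k _; rewrite fps_expE // big_distrr /=.
by apply: eq_big_seq => c; rewrite mem_compositions_in => /and3P[/eqP->].
Qed.

(** Distributivity: choosing one composition in each factor is choosing a
    member of [composition_lists ds], and the summand then depends only on the
    concatenation of these compositions and on their lengths. *)
Lemma prod_fps_comp b a ds : a 0%N = 0 ->
  \prod_(d <- ds) fps_comp b a d =
    \sum_(cs <- composition_lists ds)
      (\prod_(i <- flatten cs) a i) * \prod_(k <- shape cs) b k.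
Proof.
move=> a0; elim: ds => [|d ds IHds].
  by rewrite big_nil big_seq1 !big_nil mulr1.
rewrite big_cons fps_compE // IHds big_allpairs_dep /= big_distrl /=.
apply: eq_bigr => c _; rewrite big_distrr /=; apply: eq_bigr => cs _.
by rewrite big_cat big_cons /= [b _ * _]mulrC mulrACA.
Qed.

(** All parts of a type are positive, so a defining sequence may be taken to
    vanish at 0, as the composition of power series requires. *)
Lemma defining_seq_gen_fun (f : op_fun R) : Defs.multiplicative f ->
  defining_seq f (gen_fun f).
Proof.
case=> a fa n s p sp; rewrite fa; apply: eq_big_seq => k.
have [/negP s0 _ _] := op_leP sp.
by case: (posnP k) => [-> //|k0 _]; rewrite (gen_fun_defining_seq fa).
Qed.

(** Reindexing of the convolution along [chain_type s p], a bijection from the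
    partitions between [s] and [p] to [composition_lists]: it is injective since
    its concatenation is the type of [s, r], which determines [r]. *)
Lemma op_conv_defining_seq (f g : op_fun R) a b : a 0%N = 0 ->
  defining_seq f a -> defining_seq g b ->
  defining_seq (op_conv f g) (fps_comp b a).
Proof.
move=> a0 fa gb n s p sp; rewrite prod_fps_comp // /op_conv.
pose F cs := (\prod_(i <- flatten cs) a i) * \prod_(k <- shape cs) b k.
pose phi (r : {r | (s <=o r) && (r <=o p)}) := chain_type s p (val r).
transitivity (\sum_r F (phi r)).
  apply: eq_bigr => r _; rewrite fa gb /F /phi.
  have /andP[sr rp] := valP r.
  by have [-> -> _] := chain_typeK sr rp.
rewrite -(big_map phi predT F); apply: perm_big; apply: uniq_perm.
- rewrite map_inj_uniq ?index_enum_uniq // => r r' eq_phi; apply: val_inj.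
  have /andP[sr rp] := valP r; have /andP[sr' rp'] := valP r'.
  apply: (interval_type_inj sr sr').
  have [<- _ _] := chain_typeK sr rp; have [<- _ _] := chain_typeK sr' rp'.
  exact: congr1 eq_phi.
- exact: composition_lists_uniq.
- move=> cs; rewrite mem_composition_lists; apply/mapP/andP => [[r _ ->]|].
    have /andP[sr rp] := valP r; have [-> _ ->] := chain_typeK sr rp.
    by have [-> _ _] := op_leP sr.
  case=> /eqP cs_d cs0; have [r srp <-] := chain_type_ex sp cs_d cs0.
  by exists (Sub r srp); rewrite ?mem_index_enum // /phi SubK.
Qed.

End Series.

Theorem corollaryA27 (R : realType) (f g : op_fun R)
    (hf : multiplicative f) (hg : multiplicative g) :
  multiplicative (op_conv f g) /\
  gen_fun (op_conv f g) =1 fps_comp (gen_fun g) (gen_fun f).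
Proof.
have conv : defining_seq (op_conv f g) (fps_comp (gen_fun g) (gen_fun f)).
  by apply: op_conv_defining_seq => //; apply: defining_seq_gen_fun.
split; first by exists (fps_comp (gen_fun g) (gen_fun f)).
case=> [|n]; last exact: gen_fun_defining_seq conv _.
by rewrite /= /fps_comp big_ord1 /= GRing.mul0r.
Qed.
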